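(* Let $\lambda,\mu>0$ with $\lambda\mu<4$, let $T:\mathcal H\to\mathcal H$ be $\lambda$-RFNE and $U:\mathcal H\to\mathcal H$ be $\mu$-RFNE with $\operatorname{Fix}(UT)\neq\emptyset$, and let $\nu^*:=\frac{4(\lambda+\mu-\lambda\mu)}{4-\lambda\mu}$. Let $z\in\operatorname{Fix}(UT)$ be fixed and let $$\tau^*(x,z):=\frac{\|a_1+b_1\|^2}{\frac1\lambda\|a_1-a_2\|^2+\frac1\mu\|b_1-b_2\|^2+\langle a_1-a_2,b_1-b_2\rangle}\quad\text{if }x\notin\operatorname{Fix}(UT),\qquad \tau^*(x,z):=1\quad\text{otherwise},$$ where $a_1:=T(x)-x$, $a_2:=T(z)-z$, $b_1:=UT(x)-T(x)$, $b_2:=UT(z)-T(z)$. Let the function $\tau:\mathcal H\to(0,+\infty)$ be such that $\tau^*(x,z)\le\tau(x)\le\nu^*$ for $x\notin\operatorname{Fix}(UT)$. Then the operator $UT$ is a generalized $\tau$-relaxed cutter; consequently, $(UT)_{1/\tau}$ is a cutter which is an extrapolation of the cutter $(UT)_{1/\nu^*}$. Moreover, $(UT)_{1/\tau}$ satisfies the demi closedness principle.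
   Context: $\mathcal H$ is a real Hilbert space with $\mathcal H\neq\{0\}$; $UT$ denotes the composition $U\circ T$; $\operatorname{Fix}S:=\{z\in\mathcal H:S(z)=z\}$. For a function $\sigma:\mathcal H\to(0,+\infty)$ (in particular a positive constant), the generalized relaxation of an operator $S:\mathcal H\to\mathcal H$ is $S_\sigma(x):=x+\sigma(x)(S(x)-x)$. If $\sigma(x)\ge1$ for all $x\in\mathcal H$ and $\sigma(x)>1$ for at least one $x\notin\operatorname{Fix}S$, then $S_\sigma$ is called an extrapolation of $S$. An operator $S$ is firmly nonexpansive (FNE) if $\langle S(x)-S(y),x-y\rangle\ge\|S(x)-S(y)\|^2$ for all $x,y\in\mathcal H$; an operator is $\lambda$-RFNE ($\lambda$-relaxed firmly nonexpansive), $\lambda>0$, if it equals $S_\lambda$ for some FNE operator $S$. An operator $S$ with $\operatorname{Fix}S\neq\emptyset$ is a cutter if $\langle z-x,S(x)-x\rangle\ge\|S(x)-x\|^2$ for all $x\in\mathcal H$ and $z\in\operatorname{Fix}S$. A generalized $\tau$-relaxed cutter is an operator of the form $C_\tau$ with $C$ a cutter; equivalently, an operator $S$ with $\operatorname{Fix}S\neq\emptyset$ and $\tau(x)\langle z-x,S(x)-x\rangle\ge\|S(x)-x\|^2$ for all $x\in\mathcal H$, $z\in\operatorname{Fix}S$. An operator $S$ satisfies the demi closedness principle if for any bounded sequence $\{x^k\}$ with $\|S(x^k)-x^k\|\to0$, every weak cluster point of $\{x^k\}$ belongs to $\operatorname{Fix}S$.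
   Formalization: That (UT)_{1/τ} is an extrapolation of (UT)_{1/ν*} is claimed only if τ(x)<ν* for some x∉Fix(UT), as it fails for τ=ν* (e.g. T=U=0, λ=μ=1); in general (UT)_{1/τ} is shown to be a generalized relaxation of (UT)_{1/ν*} with some σ≥1. *)

(* Defs.v *)
From HB Require Import structures.
From mathcomp Require Import all_boot all_order all_algebra.
From mathcomp Require Import all_classical all_reals all_analysis.
Set Implicit Arguments.
Unset Strict Implicit.
Unset Printing Implicit Defensive.
Import Order.TTheory GRing.Theory Num.Theory.
Import numFieldNormedType.Exports.
Local Open Scope classical_set_scope.
Local Open Scope ring_scope.

(* A real Hilbert space is a complete normed space H over R : realType with a
   positive definite symmetric bilinear form dot inducing its norm; the last
   condition is [induces_norm]. *)
Definition induces_norm (R : realType) (H : completeNormedModType R)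
    (dot : {dot H for @idfun R}) : Prop :=
  forall x : H, dot x x = `|x| ^+ 2.

Definition Fix (H : Type) (S : H -> H) : set H := [set z | S z = z].

Definition relaxation (R : realType) (H : completeNormedModType R)
    (S : H -> H) (sigma : H -> R) : H -> H :=
  fun x => x + sigma x *: (S x - x).

Definition is_extrapolation (R : realType) (H : completeNormedModType R)
    (V S : H -> H) : Prop :=
  exists sigma : H -> R,
    [/\ forall x, 1 <= sigma x,
        exists2 x, ~ Fix S x & 1 < sigma x
      & V = relaxation S sigma].

Definition firmly_nonexpansive (R : realType) (H : completeNormedModType R)
    (dot : {dot H for @idfun R}) (S : H -> H) : Prop :=
  forall x y, `|S x - S y| ^+ 2 <= dot (S x - S y) (x - y).

Definition relaxed_firmly_nonexpansive (R : realType)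
    (H : completeNormedModType R) (dot : {dot H for @idfun R})
    (lambda : R) (T : H -> H) : Prop :=
  exists2 S : H -> H, firmly_nonexpansive dot S
    & T = relaxation S (fun=> lambda).

Definition is_cutter (R : realType) (H : completeNormedModType R)
    (dot : {dot H for @idfun R}) (S : H -> H) : Prop :=
  Fix S !=set0 /\
  forall x z, Fix S z -> `|S x - x| ^+ 2 <= dot (z - x) (S x - x).

Definition generalized_relaxed_cutter (R : realType)
    (H : completeNormedModType R) (dot : {dot H for @idfun R})
    (tau : H -> R) (S : H -> H) : Prop :=
  exists2 C : H -> H, is_cutter dot C & S = relaxation C tau.

Definition weakly_converges (R : realType) (H : completeNormedModType R)
    (dot : {dot H for @idfun R}) (u : nat -> H) (x : H) : Prop :=
  forall y : H, dot (u n) y @[n --> \oo] --> (dot x y : R).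

Definition weak_cluster_point (R : realType) (H : completeNormedModType R)
    (dot : {dot H for @idfun R}) (u : nat -> H) (x : H) : Prop :=
  exists2 f : nat -> nat, increasing_seq f & weakly_converges dot (u \o f) x.

Definition demi_closedness_principle (R : realType)
    (H : completeNormedModType R) (dot : {dot H for @idfun R})
    (S : H -> H) : Prop :=
  forall u : nat -> H, bounded_fun u ->
    `|S (u n) - u n| @[n --> \oo] --> (0 : R) ->
    forall x, weak_cluster_point dot u x -> Fix S x.

Definition nu_star (R : realType) (lambda mu : R) : R :=
  4 * (lambda + mu - lambda * mu) / (4 - lambda * mu).

Definition tau_star (R : realType) (H : completeNormedModType R)
    (dot : {dot H for @idfun R}) (lambda mu : R) (T U : H -> H) (x z : H) : R :=
  let a1 := T x - x in
  let a2 := T z - z in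
  let b1 := U (T x) - T x in
  let b2 := U (T z) - T z in
  if x \in Fix (U \o T) then 1
  else `|a1 + b1| ^+ 2 /
       (lambda^-1 * `|a1 - a2| ^+ 2 + mu^-1 * `|b1 - b2| ^+ 2
        + dot (a1 - a2) (b1 - b2)).

(* Main.v *)
Require Import Defs.
From HB Require Import structures.
From mathcomp Require Import all_boot all_order all_algebra.
From mathcomp Require Import all_classical all_reals all_analysis.
From mathcomp Require Import ring lra.
Set Implicit Arguments.
Unset Strict Implicit.
Unset Printing Implicit Defensive.
Import Order.TTheory GRing.Theory Num.Theory.
Import numFieldNormedType.Exports.
Local Open Scope classical_set_scope.
Local Open Scope ring_scope.

(** Write [D x := UT x - x] for the displacement of the composition.  The
    displacement of a [lambda]-RFNE operator [T] satisfies
    [|(T x - x) - (T y - y)|^2 <= lambda <y - x, (T x - x) - (T y - y)>].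
    Adding this for [T] at [x, y] to its analogue for [U] at [T x, T y], and
    rewriting [T y - T x] as [(y - x) - a] with
    [a := (T x - x) - (T y - y)] and
    [b := (U (T x) - T x) - (U (T y) - T y)], gives ([couplingTU_le])

      [Q a b := |a|^2 / lambda + |b|^2 / mu + <a, b> <= <y - x, D x - D y>],

    where [a + b = D x - D y].  The form [Q] is the denominator of [tau_star].
    When [lambda * mu < 4] it is positive definite; more precisely,
    [nu_star * Q a b - |a + b|^2] is a multiple of a square
    ([sqr_norm_le_coupling]).  Three consequences make up the theorem.

    - If [x] and [y] are both fixed by [UT], the right-hand side above vanishes,
      hence so do [a] and [b]: the steps [T z - z] and [U (T z) - T z] are the
      same for all fixed points [z] ([fixed_displacement]).  Thus
      [tau_star x z] does not depend on [z], although a cutter has to satisfy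
      its inequality against every fixed point.
    - If [y] is fixed and [x] is not, then [Q a b > 0], and
      [tau_star x y <= tau x] reads
      [|D x|^2 <= tau x * Q a b <= tau x * <y - x, D x>], the relaxed cutter
      inequality ([tau_star_cutter]).  Relaxing with a larger [tau] only weakens
      it, so it also holds with [nu_star].
    - For arbitrary [x, y], [|D x - D y|^2 <= nu_star * <y - x, D x - D y>].
      If [u n] converges weakly to [x], is bounded and [D (u n)] tends to 0, the
      right-hand side at [u n, x] tends to 0 while the left-hand side tends to
      [|D x|^2]; hence [D x = 0] ([displacementUT_demiclosed]).  Since
      [tau <= nu_star] off the fixed points, when the
      displacements of [(UT)_(1/tau)] along a sequence tend to 0, so do those
      of [UT]. *)

(** * The inner product *)

Section InnerProduct.
Context (R : realType) (H : completeNormedModType R).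
Context (dot : {dot H for @idfun R}).
Implicit Types (u v w : H) (k : R).

Lemma dotC u v : dot u v = dot v u.
Proof. by rewrite (@hermC _ false (@idfun R)) expr0 mul1r. Qed.

Lemma dotDl u v w : dot (u + v) w = dot u w + dot v w.
Proof. exact: linearDl. Qed.

Lemma dotNl u w : dot (- u) w = - dot u w.
Proof. exact: linearNl. Qed.

Lemma dotZl k u w : dot (k *: u) w = k * dot u w.
Proof. exact: linearZl_LR. Qed.

Lemma dotDr u v w : dot u (v + w) = dot u v + dot u w.
Proof. by rewrite dotC dotDl !(dotC u). Qed.

Lemma dotNr u w : dot u (- w) = - dot u w.
Proof. by rewrite dotC dotNl dotC. Qed.

Lemma dotZr k u w : dot u (k *: w) = k * dot u w.
Proof. by rewrite dotC dotZl dotC. Qed.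

Definition dot_linE := (dotDl, dotDr, dotNl, dotNr, dotZl, dotZr).

Context (dotE : induces_norm dot).

(** Cauchy-Schwarz, read off from the square of [|v| u - |u| v]. *)
Lemma normr_dot_le u v : `|dot u v| <= `|u| * `|v|.
Proof.
have half w : dot w v <= `|w| * `|v|.
  have [->|w0] := eqVneq w 0; first by rewrite linear0l normr0 mul0r.
  have [->|v0] := eqVneq v 0; first by rewrite linear0r normr0 mulr0.
  have pw : 0 < `|w| by rewrite normr_gt0.
  have pv : 0 < `|v| by rewrite normr_gt0.
  have := sqr_ge0 `| `|v| *: w - `|w| *: v |.
  rewrite -dotE !dot_linE !dotE (dotC v w) => h.
  rewrite -(ler_pM2l (mulr_gt0 pw pv)); nra.
by rewrite ler_norml half andbT lerNl -dotNl -(normrN u) half.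
Qed.

End InnerProduct.

(** * Subsequences *)

Lemma increasing_cvg_infty (f : nat -> nat) :
  increasing_seq f -> f n @[n --> \oo] --> \oo.
Proof.
move=> f_incr; have le_f n : (n <= f n)%N.
  elim: n => // n; rewrite -ltnS => /leq_trans; apply.
  by move/increasing_seqP : f_incr; exact.
by apply/cvgnyPge => A; near=> n; rewrite (leq_trans _ (le_f n))//; near: n;
  exact: nbhs_infty_ge.
Unshelve. all: end_near. Qed.

(** * Generalized relaxations *)

Section Relaxation.
Context (R : realType) (H : completeNormedModType R).
Context (dot : {dot H for @idfun R}).

Lemma relaxation_disp (S : H -> H) (s : H -> R) x :
  relaxation S s x - x = s x *: (S x - x).
Proof. by rewrite /relaxation addrC addKr. Qed.

Lemma Fix_relaxation (S : H -> H) (s : H -> R) :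
  (forall x, s x != 0) -> Fix (relaxation S s) = Fix S.
Proof.
move=> s0; apply/seteqP; split=> x /eqP;
  rewrite -subr_eq0 ?relaxation_disp => h; apply/eqP; rewrite -subr_eq0.
  by move: h; rewrite scaler_eq0 (negPf (s0 x)).
by rewrite relaxation_disp (eqP h) scaler0.
Qed.

Lemma relaxation_relaxation (S : H -> H) (s t : H -> R) :
  relaxation (relaxation S s) t = relaxation S (fun x => t x * s x).
Proof.
apply/funext => x; rewrite {1}/relaxation relaxation_disp scalerA.
by rewrite /relaxation.
Qed.

(** The inequality is asked at non-fixed points only: at a fixed point both
    sides vanish, and there the relaxation function of the theorem is positive
    but otherwise arbitrary. *)
Lemma relaxation_cutter (S : H -> H) (t : H -> R) :
  (forall x, 0 < t x) -> Fix S !=set0 ->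
  (forall x w, Fix S w -> ~ Fix S x ->
     `|S x - x| ^+ 2 <= t x * dot (w - x) (S x - x)) ->
  is_cutter dot (relaxation S (fun x => (t x)^-1)).
Proof.
move=> t0 S0 h; rewrite /is_cutter Fix_relaxation; last first.
  by move=> x; rewrite invr_eq0 gt_eqF.
split=> // x w Fw; rewrite relaxation_disp dotZr normrZ exprMn.
rewrite gtr0_norm ?invr_gt0// expr2 -mulrA ler_pM2l ?invr_gt0//.
rewrite ler_pdivrMl//.
have [Fx|Fx] := pselect (Fix S x); last exact: h.
by rewrite Fx subrr normr0 expr0n -(scale0r w) dotZr mul0r mulr0.
Qed.

End Relaxation.

(** * The composition of two relaxed firmly nonexpansive operators *)

Section Composition.
Context (R : realType) (H : completeNormedModType R).
Context (dot : {dot H for @idfun R}) (dotE : induces_norm dot).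

(** Firm nonexpansiveness of [F] is equivalent to that of [id - F], and the
    displacement of the relaxation is [- k] times [id - F]. *)
Lemma displacement_rfne (k : R) (S : H -> H) : 0 < k ->
  relaxed_firmly_nonexpansive dot k S -> forall x y,
  k^-1 * `|(S x - x) - (S y - y)| ^+ 2 <= dot (y - x) ((S x - x) - (S y - y)).
Proof.
move=> k0 [F F_fne ->] x y; rewrite !relaxation_disp -scalerBr.
have -> : F x - x - (F y - y) = (F x - F y) - (x - y).
  by rewrite !opprD addrACA.
rewrite -(opprB x y); have := F_fne x y.
move: (F x - F y) (x - y) => p q.
rewrite -!dotE !dot_linE (dotC dot q p) => h.
rewrite !mulrA mulVf ?gt_eqF// !mul1r; nra.
Qed.

Variables (lambda mu : R) (lambda_gt0 : 0 < lambda) (mu_gt0 : 0 < mu).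
Hypothesis lambda_mu_lt4 : lambda * mu < 4.

Definition coupling (a b : H) : R :=
  lambda^-1 * `|a| ^+ 2 + mu^-1 * `|b| ^+ 2 + dot a b.

(** The arithmetic-geometric mean inequality gives
    [(lambda + mu)^2 >= 4 * lambda * mu > (lambda * mu)^2]. *)
Lemma relaxation_excess_gt0 : 0 < lambda + mu - lambda * mu.
Proof.
have p_gt0 : 0 < lambda * mu by rewrite mulr_gt0.
have p_sqr : (lambda * mu) ^+ 2 < 4 * (lambda * mu).
  by rewrite expr2 ltr_pM2r.
rewrite subr_gt0 -(@ltr_pXn2r _ 2) ?nnegrE ?ltW ?addr_gt0//.
apply: lt_le_trans p_sqr _; rewrite -subr_ge0.
have -> : (lambda + mu) ^+ 2 - 4 * (lambda * mu) = (lambda - mu) ^+ 2 by ring.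
exact: sqr_ge0.
Qed.

Lemma nu_star_gt0 : 0 < nu_star lambda mu.
Proof.
rewrite /nu_star divr_gt0 ?mulr_gt0 ?relaxation_excess_gt0//.
by rewrite subr_gt0.
Qed.

(** The coefficient [nu_star] is exactly the one for which the difference of the
    two sides degenerates to a multiple of the square of
    [mu (2 - lambda) a - lambda (2 - mu) b]. *)
Lemma sqr_norm_le_coupling a b :
  `|a + b| ^+ 2 <= nu_star lambda mu * coupling a b.
Proof.
have d0 : 0 < 4 - lambda * mu by rewrite subr_gt0.
have := sqr_ge0 `|(mu * (2 - lambda)) *: a - (lambda * (2 - mu)) *: b|.
rewrite /coupling /nu_star -!dotE !dot_linE !(dotC dot b a) => h.
rewrite mulrAC ler_pdivlMr//.
rewrite -(ler_pM2l (mulr_gt0 lambda_gt0 mu_gt0)) -subr_ge0.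
apply: le_trans h _; rewrite le_eqVlt; apply/orP; left; apply/eqP.
by field; rewrite !gt_eqF.
Qed.

(** On the line [a = - b] the form reduces to
    [(lambda + mu - lambda * mu) / (lambda * mu) * |b|^2]. *)
Lemma coupling_le0_eq0 a b : a + b = 0 -> coupling a b <= 0 -> a = 0 /\ b = 0.
Proof.
move=> /eqP; rewrite addr_eq0 => /eqP ->.
rewrite /coupling normrN -!dotE !dot_linE dotE => h.
suff : b = 0 by move=> ->; rewrite oppr0.
have p : 0 < (lambda + mu - lambda * mu) / (lambda * mu).
  by rewrite divr_gt0 ?relaxation_excess_gt0 ?mulr_gt0.
apply/eqP; rewrite -normr_eq0 -sqrf_eq0 eq_le sqr_ge0 andbT.
rewrite -(pmulr_rle0 _ p); apply: le_trans h; rewrite le_eqVlt; apply/orP; left.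
by apply/eqP; field; rewrite !gt_eqF.
Qed.

Variables (T U : H -> H).
Hypothesis T_rfne : relaxed_firmly_nonexpansive dot lambda T.
Hypothesis U_rfne : relaxed_firmly_nonexpansive dot mu U.

Definition couplingTU (x y : H) : R :=
  coupling (T x - x - (T y - y)) (U (T x) - T x - (U (T y) - T y)).

Lemma displacementUT x y :
  (T x - x - (T y - y)) + (U (T x) - T x - (U (T y) - T y)) =
  ((U \o T) x - x) - ((U \o T) y - y).
Proof.
by rewrite /= addrACA -opprD (addrC (T x - x)) (addrC (T y - y)) !subrKA.
Qed.

(** The inner product of the two steps enters because the inequality for [U]
    concerns [T y - T x], which differs from [y - x] by the step of [T]. *)
Lemma couplingTU_le x y :
  couplingTU x y <= dot (y - x) (((U \o T) x - x) - ((U \o T) y - y)).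
Proof.
rewrite -displacementUT /couplingTU /coupling.
have hT := displacement_rfne lambda_gt0 T_rfne x y.
have := displacement_rfne mu_gt0 U_rfne (T x) (T y).
have -> : T y - T x = (y - x) - (T x - x - (T y - y)).
  by rewrite (opprB (T x - x)) addrA (addrC (y - x)) subrKA opprB subrKA.
move: hT; move: (T x - x - _) (U (T x) - T x - _) => a b.
by rewrite !dot_linE; lra.
Qed.

(** The displacement of the composition vanishes at both points, so
    [couplingTU_le] forces the positive definite form to be at most 0. *)
Lemma fixed_displacement z w : Fix (U \o T) z -> Fix (U \o T) w ->
  T w - w = T z - z /\ U (T w) - T w = U (T z) - T z.
Proof.
move=> Fz Fw; have := couplingTU_le w z.
have Dwz : ((U \o T) w - w) - ((U \o T) z - z) = 0.
  by rewrite Fz Fw !subrr.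
rewrite Dwz -(scale0r w) dotZr mul0r => /coupling_le0_eq0.
rewrite displacementUT => /(_ Dwz)[/eqP + /eqP].
by rewrite !subr_eq0 => /eqP -> /eqP ->.
Qed.

(** The reference point [z] in [tau_star] and the point [w] of the inequality
    may differ: by [fixed_displacement] they give the same denominator. *)
Lemma tau_star_cutter x z w (t : R) :
  Fix (U \o T) z -> Fix (U \o T) w -> ~ Fix (U \o T) x ->
  tau_star dot lambda mu T U x z <= t ->
  `|(U \o T) x - x| ^+ 2 <= t * dot (w - x) ((U \o T) x - x).
Proof.
move=> Fz Fw Fx; rewrite /tau_star memNset//.
have [<- <-] := fixed_displacement Fz Fw.
have Dw : (U \o T) w - w = 0 by rewrite Fw subrr.
have DE := displacementUT x w; rewrite Dw subr0 in DE.
have D0 : T x - x + (U (T x) - T x) = (U \o T) x - x.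
  by rewrite /= addrC subrKA.
rewrite -/(coupling _ _) -/(couplingTU x w) D0.
have n0 : 0 < `|(U \o T) x - x| ^+ 2.
  by rewrite exprn_gt0// normr_gt0 subr_eq0; exact/eqP.
have c0 : 0 < couplingTU x w.
  rewrite -(pmulr_rgt0 _ nu_star_gt0); apply: lt_le_trans n0 _.
  by rewrite -DE; exact: sqr_norm_le_coupling.
rewrite ler_pdivrMr// => ht.
have t0 : 0 < t by rewrite -(pmulr_lgt0 _ c0); exact: lt_le_trans ht.
apply: le_trans ht _; rewrite ler_pM2l//; apply: le_trans (couplingTU_le x w) _.
by rewrite Dw subr0.
Qed.

(** [UT] need not be nonexpansive here ([nu_star] may exceed 2); the argument
    uses only that [UT] is [nu_star]-RFNE, in terms of displacements. *)
Lemma displacementUT_demiclosed (u : nat -> H) x : bounded_fun u ->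
  `|(U \o T) (u n) - u n| @[n --> \oo] --> (0 : R) ->
  weak_cluster_point dot u x -> Fix (U \o T) x.
Proof.
move=> [M [_ uM]] du0 [f f_incr fx].
set e := (U \o T) x - x; pose d n := (U \o T) (u (f n)) - u (f n).
have nd0 : `|d n| @[n --> \oo] --> (0 : R).
  by have /= := cvg_comp _ _ (increasing_cvg_infty f_incr) du0.
have d0 : d n @[n --> \oo] --> (0 : H) by exact: norm_cvg0.
pose K := `|M| + 1; have uK n : `|u n| <= K.
  by apply: uM => //; rewrite /K ltr_pwDr// ler_norm.
(* Both sides of [`|d n - e| ^+ 2 <= b n] have limits along the subsequence,
   [`|e| ^+ 2] and 0. *)
have lhs : `|d n - e| ^+ 2 @[n --> \oo] --> `|0 - e| ^+ 2.
  have h : `|d n - e| @[n --> \oo] --> (`|0 - e| : R).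
    by apply: cvg_norm; apply: cvgB => //; exact: cvg_cst.
  by rewrite expr2; under eq_fun do rewrite expr2; exact: cvgM.
pose b n := nu_star lambda mu *
  ((`|x| + K) * `|d n| + (dot (u (f n)) e - dot x e)).
have rhs : b n @[n --> \oo] --> (0 : R).
  have -> : (0 : R) = nu_star lambda mu *
    ((`|x| + K) * 0 + (dot x e - dot x e)) by rewrite subrr mulr0 addr0 mulr0.
  apply: cvgM; first exact: cvg_cst.
  apply: cvgD; first by apply: cvgM => //; exact: cvg_cst.
  by apply: cvgB; [exact: fx|exact: cvg_cst].
have le_b n : `|d n - e| ^+ 2 <= b n.
  rewrite /d /e -displacementUT; apply: le_trans (sqr_norm_le_coupling _ _) _.
  rewrite ler_pM2l ?nu_star_gt0//; apply: le_trans (couplingTU_le _ _) _.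
  have splitE c : dot (x - u (f n)) (d n - c) =
      dot (x - u (f n)) (d n) + (dot (u (f n)) c - dot x c).
    by move: (d n) => c'; rewrite !dot_linE; ring.
  rewrite -/(d n) -/e splitE lerD2r; apply: le_trans (ler_norm _) _.
  apply: le_trans (normr_dot_le dotE _ _) _.
  rewrite ler_wpM2r// (le_trans (ler_normB _ _))// lerD2l; exact: uK.
have : `|0 - e| ^+ 2 <= 0.
  by apply: (ler_cvg_to lhs rhs); near=> n; exact: le_b.
rewrite sub0r normrN => h; apply/eqP; rewrite -subr_eq0 -/e -normr_eq0.
by rewrite -sqrf_eq0 eq_le h sqr_ge0.
Unshelve. all: end_near. Qed.

End Composition.

(** * Relaxed cutters from extrapolated compositions *)

Theorem theorem3p13 (R : realType) (H : completeNormedModType R)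
    (dot : {dot H for @idfun R}) (dotE : induces_norm dot)
    (H_neq0 : exists x : H, x != 0)
    (lambda mu : R) (lambda_gt0 : 0 < lambda) (mu_gt0 : 0 < mu)
    (lambda_mu_lt4 : lambda * mu < 4)
    (T U : H -> H)
    (T_rfne : relaxed_firmly_nonexpansive dot lambda T)
    (U_rfne : relaxed_firmly_nonexpansive dot mu U)
    (FixUT_neq0 : Fix (U \o T) !=set0)
    (z : H) (Fix_z : Fix (U \o T) z)
    (tau : H -> R) (tau_gt0 : forall x, 0 < tau x)
    (tau_bounds : forall x, ~ Fix (U \o T) x ->
       tau_star dot lambda mu T U x z <= tau x <= nu_star lambda mu) :
  let V := relaxation (U \o T) (fun x => (tau x)^-1) in
  let W := relaxation (U \o T) (fun=> (nu_star lambda mu)^-1) in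
  [/\ generalized_relaxed_cutter dot tau (U \o T),
      is_cutter dot V,
      is_cutter dot W /\
        (exists2 sigma : H -> R,
           forall x, 1 <= sigma x & V = relaxation W sigma) /\
        ((exists2 x, ~ Fix (U \o T) x & tau x < nu_star lambda mu) ->
           is_extrapolation V W)
    & demi_closedness_principle dot V].
Proof.
move=> V W; set nu := nu_star lambda mu in tau_bounds W *.
have nu_gt0 : 0 < nu by exact: nu_star_gt0.
have tau_ineq x w : Fix (U \o T) w -> ~ Fix (U \o T) x ->
    `|(U \o T) x - x| ^+ 2 <= tau x * dot (w - x) ((U \o T) x - x).
  move=> Fw Fx; have /andP[tau_ge _] := tau_bounds x Fx.
  exact: (tau_star_cutter dotE lambda_gt0 mu_gt0 _ _ _ Fix_z).
have V_cutter : is_cutter dot V by exact: relaxation_cutter.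
have W_cutter : is_cutter dot W.
  apply: (@relaxation_cutter _ _ _ _ (fun=> nu)) => // x w Fw Fx.
  have /andP[tau_ge tau_le] := tau_bounds x Fx.
  have ineq := tau_ineq x w Fw Fx; apply: le_trans ineq _.
  rewrite ler_wpM2r// -(pmulr_rge0 _ (tau_gt0 x)).
  exact: le_trans (sqr_ge0 _) (tau_ineq x w Fw Fx).
have FixV : Fix V = Fix (U \o T).
  by apply: Fix_relaxation => x; rewrite invr_eq0 gt_eqF.
have FixW : Fix W = Fix (U \o T).
  by apply: Fix_relaxation => x; rewrite invr_eq0 gt_eqF.
(* At fixed points any value works, as the displacement is 0 there; it must
   only be at least 1. *)
pose sigma x := if x \in Fix (U \o T) then 1 else nu / tau x.
have sigma_ge1 x : 1 <= sigma x.
  rewrite /sigma; case: ifPn => // /negP Fx.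
  rewrite ler_pdivlMr// mul1r.
  by have /andP[] := tau_bounds x (fun h => Fx (mem_set h)).
have VW : V = relaxation W sigma.
  rewrite /W relaxation_relaxation; apply/funext => x.
  rewrite /V /relaxation /sigma; case: ifPn => [/set_mem -> | _].
    by rewrite subrr !scaler0.
  by rewrite mulrAC divff ?gt_eqF// mul1r.
split => //.
- exists V => //; rewrite /V relaxation_relaxation; apply/funext => x.
  by rewrite /relaxation divff ?gt_eqF// scale1r addrC subrK.
- split=> //; split; first by exists sigma.
  case=> x Fx tau_lt; exists sigma; split=> //; exists x; first by rewrite FixW.
  by rewrite /sigma memNset// ltr_pdivlMr// mul1r.
move=> u u_bnd Vu0 x ux; rewrite FixV.
apply: (displacementUT_demiclosed dotE lambda_gt0 mu_gt0 _ _ _ u_bnd _ ux) => //.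
apply: (@squeeze_cvgr _ _ _ _ (fun=> 0) (fun n => nu * `|V (u n) - u n|)).
- near=> n; apply/andP; split=> //; rewrite relaxation_disp normrZ mulrA.
  have [Fu|/tau_bounds/andP[_ tau_le]] := pselect (Fix (U \o T) (u n)).
    by rewrite Fu subrr normr0 mulr0.
  by rewrite ler_peMl// gtr0_norm ?invr_gt0// ler_pdivlMr// mul1r.
- exact: cvg_cst.
- by have := cvgM (cvg_cst nu) Vu0; rewrite mulr0; exact.
Unshelve. all: end_near. Qed.
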